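(* There exists a constant $C$ such that for every $1 < p < \infty$, $$\left[ \frac{u(x) - u(y)}{|x-y|^{\frac{2}{p}}} \right]_{M^p(\mathbb{R} \times \mathbb{R})} \leq C \, \|u'\|_{L^1(\mathbb{R})} \qquad \text{for all } u \in C^\infty_c(\mathbb{R}).$$
   Context: The constant $C$ is universal (independent of $p$ and $u$). $C^\infty_c(\mathbb{R})$ is the space of (real-valued) smooth compactly supported functions on $\mathbb{R}$. For $1 \le p < \infty$, the Marcinkiewicz (weak $L^p$) quasi-norm of a measurable function $f$ on $\mathbb{R} \times \mathbb{R}$ is defined by $$[f]_{M^p(\mathbb{R} \times \mathbb{R})}^p := \sup_{\lambda > 0} \lambda^p \, \mathcal{L}^{2}\bigl(\{ (x,y) \in \mathbb{R} \times \mathbb{R} : |f(x,y)| \geq \lambda \}\bigr),$$ where $\mathcal{L}^{2}$ is Lebesgue measure on $\mathbb{R} \times \mathbb{R}$. The quotient in the claim is regarded as a function of $(x,y)$ defined for $x \neq y$ (the diagonal has measure zero). *)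

(* Defs.v *)
From HB Require Import structures.
From mathcomp Require Import all_boot all_order all_algebra.
From mathcomp Require Import all_classical all_reals all_analysis.

Set Implicit Arguments.
Unset Strict Implicit.
Unset Printing Implicit Defensive.

Import Order.TTheory GRing.Theory Num.Theory.
Import numFieldNormedType.Exports.

Local Open Scope ring_scope.
Local Open Scope classical_set_scope.

Definition smooth (R : realType) (u : R -> R) : Prop :=
  forall (n : nat) (x : R), derivable (u^`(n)) x 1.

Definition compactly_supported (R : realType) (u : R -> R) : Prop :=
  compact (closure [set x | u x != 0]).

Definition Marcinkiewicz (d : measure_display) (T : measurableType d)
    (R : realType) (mu : {measure set T -> \bar R}) (p : R) (f : T -> R)
    : \bar R :=
  (ereal_sup [set (l `^ p)%:E * mu [set z | (l <= `|f z|)%R]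
             | l in [set l : R | (0 < l)%R]] `^ p^-1)%E.

(* Lebesgue measure on the plane, on the Borel sets. *)
Definition lebesgue2 (R : realType) :
    {measure set (measurableTypeR R * measurableTypeR R) -> \bar R} :=
  ((@lebesgue_measure R) \x (@lebesgue_measure R))%E.

(* On the diagonal this is 0 / 0 = 0 (for s != 0), so the diagonal belongs to
   no superlevel set with a positive level. *)
Definition diff_quotient (R : realType) (s : R) (u : R -> R) (z : R * R) : R :=
  (u z.1 - u z.2) / `|z.1 - z.2| `^ s.

(* Main.v *)
(* Let A be the L^1 norm of u'. Since |u(x) - u(y)| <= A, raising the
   inequality that defines the superlevel set of level l to the power p gives
   m |x - y|^2 <= |u(x) - u(y)| with m = l^p / A^(p - 1), and the right-hand
   side is at most the integral of |u'| over the segment [x, y]. This reduces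
   everything to the weak type estimate for p = 1, which follows from Vitali's
   lemma: among those segments choose disjoint I_j whose fivefold dilations
   contain all of them. The squares (5 I_j)^2 then cover the set, and the sum
   of 25 |I_j|^2 is at most 25 / m times the sum of the integrals of |u'| over
   the I_j, hence at most 25 A / m. *)
Require Import Defs.
From HB Require Import structures.
From mathcomp Require Import all_boot all_order all_algebra.
From mathcomp Require Import all_classical all_reals all_analysis.
From mathcomp Require Import measurable_realfun ring lra.

Import Order.TTheory GRing.Theory Num.Theory.
Import numFieldNormedType.Exports.

Local Open Scope ring_scope.
Local Open Scope classical_set_scope.

(** Vitali's lemma selects a countable set of balls, while subadditivity and series of integrals are
    about sequences. The selection may be finite, so the enumeration runs over a subset [K] of the
    naturals. *)
Lemma countable_image_nat {T : pointedType} {D : set T} : countable D ->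
  exists (K : set nat) (h : nat -> T), set_inj K h /\ h @` K = D.
Proof.
move=> /countable_injP[f finj].
have hK i : D i -> 'pinv_(fun=> point) D f (f i) = i.
  by move=> Di; apply: pinvKV => //; rewrite inE.
exists (f @` D), ('pinv_(fun=> point) D f); split.
  move=> i j /[!inE] -[x Dx <-] [y Dy <-].
  by rewrite !hK// => ->.
apply/seteqP; split.
  by move=> _ [_ [x Dx <-] <-]; rewrite hK.
by move=> x Dx; exists (f x); [exists x|rewrite hK].
Qed.

(** Segments are encoded by center and radius because Vitali's lemma is about balls; both formulas
    are symmetric in the endpoints, so their order does not matter. *)
Definition segment_center {R : realType} (z : R * R) : R := (z.1 + z.2) / 2.

Definition segment_radius {R : realType} (z : R * R) : R := `|z.1 - z.2| / 2.

Lemma closed_ball_segment {R : realType} (z : R * R) : z.1 < z.2 ->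
  closed_ball (segment_center z) (segment_radius z) = `[z.1, z.2].
Proof.
move=> z12; rewrite closed_ball_itv /segment_radius ?divr_gt0 ?normr_gt0 ?subr_eq0 ?lt_eqF//.
rewrite /segment_center ltr0_norm ?subr_lt0//.
have -> : (z.1 + z.2) / 2 - - (z.1 - z.2) / 2 = z.1 by field.
by have -> : (z.1 + z.2) / 2 + - (z.1 - z.2) / 2 = z.2 by field.
Qed.

Lemma closed_ball_segmentC {R : realType} (x y : R) :
  closed_ball (segment_center (x, y)) (segment_radius (x, y)) =
  closed_ball (segment_center (y, x)) (segment_radius (y, x)).
Proof. by rewrite /segment_center /segment_radius/= addrC distrC. Qed.

Lemma endpoints_closed_ball_segment {R : realType} (z : R * R) : z.1 != z.2 ->
  let I := closed_ball (segment_center z) (segment_radius z) in I z.1 /\ I z.2.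
Proof.
case: z => x y /=; rewrite neq_lt => /orP[xy|yx].
  by rewrite closed_ball_segment//= !in_itv/= !lexx ltW.
by rewrite closed_ball_segmentC closed_ball_segment//= !in_itv/= !lexx ltW.
Qed.

Lemma lebesgue2X {R : realType} (A B : set (measurableTypeR R)) :
  measurable A -> measurable B ->
  (lebesgue2 R (A `*` B) = @lebesgue_measure R A * @lebesgue_measure R B)%E.
Proof. exact: product_measure1E. Qed.

(** Once an interval I contains the segment of z, the square of I contains the point z, so covering
    segments on the line covers [E] in the plane. Here [g] plays the role of |u'|. *)
Lemma lebesgue2_squares_le {R : realType} (g : R -> \bar R) (m : R)
    (E : set (measurableTypeR R * measurableTypeR R)) :
  0 < m -> measurable E -> measurable_fun setT g -> (forall x, 0 <= g x)%E ->
  (\int[@lebesgue_measure R]_x g x < +oo)%E ->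
  (forall z, E z -> z.1 != z.2 /\
    ((m * `|z.1 - z.2| ^+ 2)%:E <=
     \int[@lebesgue_measure R]_(x in
       closed_ball (segment_center z) (segment_radius z)) g x)%E) ->
  (lebesgue2 R E <= (25 / m)%:E * \int[@lebesgue_measure R]_x g x)%E.
Proof.
move=> m0 mE mg g0 gfin EV.
set A := fine (\int[@lebesgue_measure R]_x g x).
have A0 : (0 <= A) by apply: fine_ge0; apply: integral_ge0.
have AE : (\int[@lebesgue_measure R]_x g x = A%:E)%E.
  by rewrite fineK// ge0_fin_numE// integral_ge0.
have le_A S : measurable S ->
    (\int[@lebesgue_measure R]_(x in S) g x <= A%:E)%E.
  by move=> mS; rewrite -AE; apply: ge0_subset_integral.
(* Off E the radius is set to 1, as Vitali's lemma requires nonempty balls. *)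
pose rad (z : R * R) := if z.1 == z.2 then 1 else segment_radius z.
have rad0 z : 0 < rad z.
  by rewrite /rad; case: eqVneq => // z12; rewrite divr_gt0// normr_gt0 subr_eq0.
have radE z : E z -> rad z = segment_radius z.
  by move=> /EV[+ _]; rewrite /rad => /negbTE->.
pose B z := ball (segment_center z) (rad z).
have radB z : (radius (B z))%:num = rad z by rewrite radius_ball_num// ltW.
have Ebound z : E z -> m * (rad z *+ 2) ^+ 2 <= A.
  move=> Ez; have [_] := EV _ Ez; rewrite radE// => h.
  have : ((m * `|z.1 - z.2| ^+ 2)%:E <= A%:E)%E.
    apply: le_trans h _; apply: le_A.
    by rewrite closed_ball_itv// -?radE//; exact: measurable_itv.
  rewrite lee_fin; congr (_ * _ ^+ 2 <= _).
  by rewrite /segment_radius; field.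
(* Vitali's lemma needs bounded radii. With r the radius, [Ebound] gives 4 r^2 <= A / m, and r <= 4
   r^2 + 1 avoids a square root. *)
have VBr z : E z -> (radius (B z))%:num <= A / m + 1.
  move=> Ez; rewrite radB; have := Ebound _ Ez; have := rad0 z.
  move=> r0; rewrite mulrC -ler_pdivlMr// => h.
  have : 0 <= A / m by rewrite divr_ge0// ltW.
  by nra.
have BB z : is_ball (B z) by exact: is_ball_ball.
have B0 z : 0 < (radius (B z))%:num by rewrite radB.
have [D [cD DE tD covD]] := vitali_lemma_infinite BB B0 VBr.
have [K [h [hinj hD]]] := @countable_image_nat (R * R)%type D cD.
have Dh n : K n -> D (h n) by move=> Kn; rewrite -hD; exists n.
(* The disjoint balls [J n] carry the integrals and the dilated squares [Q n] carry the area; both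
   are padded with the empty set outside [K]. *)
pose J n := if n \in K then closed_ball (segment_center (h n)) (rad (h n))
            else set0.
pose I n := closed_ball (segment_center (h n)) (5 * rad (h n)).
pose Q n := if n \in K then I n `*` I n else set0.
have mcb (c r : R) : 0 < r -> measurable (closed_ball c r).
  by move=> r0; rewrite closed_ball_itv//; exact: measurable_itv.
have r5 n : 0 < 5 * rad (h n) by rewrite mulr_gt0.
have mJ n : measurable (J n) by rewrite /J; case: ifPn => // _; exact: mcb.
have mQ n : measurable (Q n : set (measurableTypeR R * measurableTypeR R)).
  rewrite /Q; case: ifPn => // _; apply: measurableX; exact: mcb.
have EQ : E `<=` \bigcup_n Q n.
  move=> z Ez; have [j [Dj _ _ Bsub]] := covD _ Ez.
  move: Dj; rewrite -hD => -[n Kn hn]; subst j.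
  exists n => //; rewrite /Q mem_set//=.
  move: Bsub; rewrite /B scale_ballE// !closure_ballE => Bsub.
  have z12 := (EV _ Ez).1.
  have [z1 z2] := endpoints_closed_ball_segment _ z12.
  by split => /=; apply: Bsub; rewrite radE.
have tJ : trivIset setT J.
  apply/trivIsetP => i j _ _ ij; rewrite /J.
  case: ifPn => [/[!inE] Ki|_]; last by rewrite set0I.
  case: ifPn => [/[!inE] Kj|_]; last by rewrite setI0.
  rewrite -!closure_ballE.
  move/trivIsetP : tD => /(_ _ _ (Dh _ Ki) (Dh _ Kj)); apply.
  by apply: contra_neq ij => hij; apply: hinj => //; rewrite inE.
have QJ n : (lebesgue2 R (Q n) <=
    (25 / m)%:E * \int[@lebesgue_measure R]_(x in J n) g x)%E.
  rewrite /Q /J; case: ifPn => [/[!inE] Kn|_]; last first.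
    by rewrite measure0 mule_ge0 ?integral_ge0// lee_fin divr_ge0// ltW.
  have Ehn : E (h n) by apply: DE; exact: Dh.
  rewrite (@lebesgue2X R (I n) (I n)); [|exact: mcb|exact: mcb].
  rewrite (lebesgue_measure_closed_ball _ (ltW (r5 n))).
  (* With r the radius of the selected ball, the square has side 10 r, and (10 r)^2 = (25 / m) * (m
     * (2 r)^2). *)
  apply: (@le_trans _ _ ((25 / m)%:E * (m * (rad (h n) *+ 2) ^+ 2)%:E)%E);
    last apply: lee_wpmul2l.
  - rewrite -!EFinM lee_fin le_eqVlt; apply/orP; left; apply/eqP.
    by field; rewrite gt_eqF.
  - by rewrite lee_fin divr_ge0// ltW.
  - rewrite radE//; apply: le_trans (EV _ Ehn).2; rewrite lee_fin /segment_radius.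
    by rewrite le_eqVlt; apply/orP; left; apply/eqP; field.
apply: (le_trans (measure_sigma_subadditive _ mQ mE EQ)).
apply: (le_trans (lee_nneseries _ (fun n _ => QJ n))) => //.
rewrite nneseriesZl; last by move=> n _; exact: integral_ge0.
rewrite -ge0_integral_bigcup//; last exact: measurable_funTS.
rewrite lee_wpmul2l//; first by rewrite lee_fin divr_ge0// ltW.
by rewrite AE; apply: le_A; exact: bigcupT_measurable.
Qed.

(** The fundamental theorem of calculus treats ordered endpoints; the symmetry of center and radius
    gives the other order. *)
Lemma normr_sub_le_integral_derive1 {R : realType} (u : R -> R) (z : R * R) :
  (forall x, derivable u x 1) -> continuous (u^`() : R -> R) -> z.1 != z.2 ->
  (`|u z.1 - u z.2|%:E <= \int[@lebesgue_measure R]_(x in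
     closed_ball (segment_center z) (segment_radius z)) `|(EFin \o u^`()) x|)%E.
Proof.
move=> du cu'; have cu : continuous u.
  by move=> x; apply: differentiable_continuous; apply/derivable1_diffP.
have le_itv a b : a < b ->
    (`|u a - u b|%:E <=
     \int[@lebesgue_measure R]_(x in `[a, b]) `|(EFin \o u^`()) x|)%E.
  move=> ab.
  have FTC : (\int[@lebesgue_measure R]_(x in `[a, b]) (EFin \o u^`()) x =
      (u b)%:E - (u a)%:E)%E.
    apply: continuous_FTC2 => //.
    - exact: continuous_subspaceT.
    - by split => [x _| |]; [exact: du|exact: cvg_at_right_filter (cu _)|
        exact: cvg_at_left_filter (cu _)].
  rewrite distrC -abse_EFin EFinB -FTC; apply: le_abse_integral => //.
  apply/measurable_EFinP; apply: measurable_funTS.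
  exact: continuous_measurable_fun.
case: z => x y /=; rewrite neq_lt => /orP[xy|yx].
  by rewrite closed_ball_segment//; exact: le_itv.
by rewrite closed_ball_segmentC closed_ball_segment// distrC; exact: le_itv.
Qed.

Lemma diff_quotient_measurable {R : realType} (s : R) (u : R -> R) :
  continuous u ->
  measurable_fun [set: measurableTypeR R * measurableTypeR R]
    (diff_quotient s u).
Proof.
move=> /continuous_measurable_fun mu.
rewrite (_ : diff_quotient s u =
    fun z => (u z.1 - u z.2) * `|z.1 - z.2| `^ (- s)); last first.
  by apply/funext => z; rewrite powRN.
apply: measurable_funM.
  by apply: measurable_funB; apply: measurableT_comp.
apply: (measurableT_comp (measurable_powR (- s))) => //.
apply: measurableT_comp => //.
exact: measurable_funB.
Qed.

(* Raise to the power p and absorb [D `^ (p - 1)] using [D <= A]. *)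
Lemma powR_quotient_le {R : realType} (p l d D A : R) :
  1 < p -> 0 < l -> 0 < d -> 0 <= D -> D <= A -> 0 < A ->
  l <= D / d `^ (2 / p) -> l `^ p / A `^ (p - 1) * d ^+ 2 <= D.
Proof.
move=> p1 l0 d0 D0 DA A0; have p0 : 0 < p by apply: lt_trans p1.
rewrite ler_pdivlMr ?powR_gt0// => lD.
have D_gt0 : 0 < D by apply: lt_le_trans lD; rewrite mulr_gt0 ?powR_gt0.
rewrite mulrAC ler_pdivrMr ?powR_gt0//.
apply: (@le_trans _ _ (D `^ p)).
  (* The exponent 2 / p is the one for which the power of [d] becomes 2 whatever [p] is. *)
  have -> : l `^ p * d ^+ 2 = (l * d `^ (2 / p)) `^ p.
    by rewrite powRM ?powR_ge0 ?ltW// -powRrM divfK ?gt_eqF// powR_mulrn ?ltW.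
  by apply: ge0_ler_powR; rewrite ?nnegrE ?mulr_ge0 ?powR_ge0// ltW.
rewrite -mulr_powRB1//.
by apply: ler_wpM2l => //; apply: ge0_ler_powR; rewrite ?nnegrE ?subr_ge0// ltW.
Qed.

Theorem corollary4p1 (R : realType) :
  exists C : R, forall p : R, 1 < p ->
    forall u : R -> R, smooth u -> compactly_supported u ->
      (Marcinkiewicz (lebesgue2 R) p (diff_quotient (2 / p) u)
         <= C%:E * 'N[@lebesgue_measure R]_1[EFin \o u^`()])%E.
Proof.
(* 25 is the square of Vitali's dilation factor 5. *)
exists 25 => p p1 u su _; have p0 : 0 < p by apply: lt_trans p1.
have du x : derivable u x 1 by exact: (su 0 x).
have cu : continuous u.
  by move=> x; apply: differentiable_continuous; apply/derivable1_diffP.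
have cu' : continuous (u^`() : R -> R).
  move=> x; apply: differentiable_continuous; apply/derivable1_diffP.
  by have := su 1 x; rewrite derive1n1.
rewrite Lnorm1; set g := fun x => `|(EFin \o u^`()) x|%E.
have g0 x : (0 <= g x)%E by exact: abse_ge0.
have mg : measurable_fun setT g.
  apply: measurableT_comp => //; apply/measurable_EFinP.
  exact: continuous_measurable_fun.
have [|gfin] := eqVneq (\int[@lebesgue_measure R]_x g x)%E +oo%E.
  by move=> ->; rewrite gt0_muley ?leey// lte_fin.
have {}gfin : (\int[@lebesgue_measure R]_x g x < +oo)%E by rewrite ltey.
set A := fine (\int[@lebesgue_measure R]_x g x).
have A0 : 0 <= A by apply: fine_ge0; apply: integral_ge0.
have AE : (\int[@lebesgue_measure R]_x g x = A%:E)%E.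
  by rewrite fineK// ge0_fin_numE// integral_ge0.
have u_int (z : R * R) := @normr_sub_le_integral_derive1 R u z du cu'.
have u_A (z : R * R) : z.1 != z.2 -> `|u z.1 - u z.2| <= A.
  move=> z12; rewrite -lee_fin; apply: le_trans (u_int z z12) _.
  rewrite -AE; apply: ge0_subset_integral => //.
  by rewrite closed_ball_itv ?divr_gt0 ?normr_gt0 ?subr_eq0//;
    exact: measurable_itv.
suff supE : (ereal_sup [set (l `^ p)%:E *
      lebesgue2 R [set z | (l <= `|diff_quotient (2 / p) u z|)%R]
    | l in [set l : R | (0 < l)%R]] <= ((25 * A) `^ p)%:E)%E.
  rewrite /Marcinkiewicz AE.
  apply: (@le_trans _ _ (((25 * A) `^ p)%:E `^ p^-1)%E).
    apply: gt0_ler_poweR => //; rewrite ?invr_ge0 ?ltW// in_itv/= leey andbT.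
      (* Monotonicity of the p-th root is applied to nonnegative values; the level 1 shows that the
         supremum is nonnegative. *)
      apply: le_ereal_sup_tmp; eexists; first by exists 1 => //=.
      by rewrite mule_ge0// lee_fin powR_ge0.
    by rewrite lee_fin powR_ge0.
  by rewrite poweR_EFin -powRrM divff ?gt_eqF// powRr1// mulr_ge0.
apply: ge_ereal_sup => _ [l /= l0 <-]; set E := [set z | _].
have mE : measurable E.
  rewrite -[E]setTI; apply: measurable_fun_le => //.
  by apply: measurableT_comp => //; exact: diff_quotient_measurable.
have E12 z : E z -> z.1 != z.2.
  apply: contraTneq => z12; rewrite /E/= /diff_quotient z12.
  by rewrite subrr mul0r normr0 -ltNge.
have EQ z : E z -> l <= `|u z.1 - u z.2| / `|z.1 - z.2| `^ (2 / p).
  by rewrite /E/= /diff_quotient normrM normfV (ger0_norm (powR_ge0 _ _)).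
(* The level m divides by a power of [A], so A = 0 is treated apart: [u] is then constant and [E] is
   empty. *)
have [Az|An0] := eqVneq A 0.
  rewrite (_ : E = set0) ?measure0 ?mule0 ?lee_fin ?powR_ge0//.
  rewrite -subset0 => z Ez; have := u_A z (E12 z Ez).
  rewrite Az normr_le0 => /eqP uz; have := EQ z Ez.
  by rewrite uz normr0 mul0r leNgt l0.
have {An0}A0 : 0 < A by rewrite lt0r An0.
have := @lebesgue2_squares_le R g (l `^ p / A `^ (p - 1)) E.
rewrite AE ltry divr_gt0 ?powR_gt0// => /(_ isT mE mg g0 isT) le_E.
apply: (@le_trans _ _ ((l `^ p)%:E * ((25 / (l `^ p / A `^ (p - 1)))%:E * A%:E))%E).
  apply: lee_wpmul2l; first by rewrite lee_fin powR_ge0.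
  apply: le_E => z Ez; split; first exact: E12.
  apply: le_trans (u_int z (E12 z Ez)); rewrite lee_fin.
  apply: powR_quotient_le => //; [|exact: u_A (E12 z Ez)|exact: EQ].
  by rewrite normr_gt0 subr_eq0 E12.
rewrite -!EFinM lee_fin.
have -> : l `^ p * (25 / (l `^ p / A `^ (p - 1)) * A) = 25 * A `^ p.
  rewrite -(mulr_powRB1 (ltW A0) p0).
  by field; rewrite !gt_eqF ?powR_gt0.
(* Since p > 1, 25 <= 25^p; this makes the constant independent of [p] after the p-th root. *)
rewrite (powRM _ _ (ltW A0))//; apply: ler_wpM2r; first exact: powR_ge0.
rewrite -[leLHS]powRr1//; apply: ler_powR; last exact: ltW.
by rewrite ler1n.
Qed.
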